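(* Let $\mathcal L_1$ be the node-based epistemic language defined in the context. For every node $\langle i,t\rangle$, every group (set) $A$ of nodes, and all formulas $\varphi,\psi\in\mathcal L_1$: (1) Both $K_{\langle i,t\rangle}$ and $C_A$ are $S5$ modalities; that is, for $\Box\in\{K_{\langle i,t\rangle},C_A\}$ the formulas $\Box\varphi\wedge\Box(\varphi\Rightarrow\psi)\Rightarrow\Box\psi$, $\ \Box\varphi\Rightarrow\varphi$, $\ \Box\varphi\Rightarrow\Box\Box\varphi$, and $\neg\Box\varphi\Rightarrow\Box\neg\Box\varphi$ are valid, and if $\varphi$ is valid then $\Box\varphi$ is valid. (2) The formula $C_A\varphi\Rightarrow E_A(\varphi\wedge C_A\varphi)$ is valid. (3) For every system $\mathcal R$: if $\mathcal R\vDash\varphi\Rightarrow E_A(\varphi\wedge\psi)$ then $\mathcal R\vDash\varphi\Rightarrow C_A\psi$.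
   Context: $\mathbb P=\{1,\dots,n\}$ is a set of agents, time ranges over $\mathbb N$, and a node is a pair $\langle i,t\rangle$ with $i\in\mathbb P$ and $t$ a time. A global state is a tuple $\langle\ell_e,\ell_1,\dots,\ell_n\rangle$ of local states of the environment and of the agents; a run is a function from times to global states, and $r_i(t)$ is the local state of agent $i$ at time $t$ in run $r$. A system $\mathcal R$ is a set of runs (the set of all possible runs, given the agents' protocol and the context in which they operate). Formulas of $\mathcal L_1$: $\varphi::=\mathsf{occurred}_t(e)\mid\varphi\wedge\varphi\mid\neg\varphi\mid K_\alpha\varphi\mid E_A\varphi\mid C_A\varphi$, where $e$ is an event, $t$ a time, $\alpha$ a node, and $A$ a group (set) of nodes; $\vee,\Rightarrow$ are the usual abbreviations. Truth is defined at pairs $(\mathcal R,r)$ with $r\in\mathcal R$; propositional connectives are as usual, and: - $(\mathcal R,r)\vDash\mathsf{occurred}_t(e)$ iff event $e$ has occurred in $r$ by time $t$; - $(\mathcal R,r)\vDash K_{\langle i,t\rangle}\varphi$ iff $(\mathcal R,r')\vDash\varphi$ for all runs $r'\in\mathcal R$ with $r_i(t)=r'_i(t)$; - $(\mathcal R,r)\vDash E_A\varphi$ iff $(\mathcal R,r)\vDash K_\alpha\varphi$ for every $\alpha\in A$; - $(\mathcal R,r)\vDash C_A\varphi$ iff $(\mathcal R,r)\vDash(E_A)^k\varphi$ for every $k\ge1$. $\mathcal R\vDash\psi$ ($\psi$ is valid in $\mathcal R$) means $(\mathcal R,r)\vDash\psi$ for all $r\in\mathcal R$; $\psi$ is valid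 if it is valid in every system $\mathcal R$.
   Formalization: The axiom C_A φ ⇒ φ is stated only for nonempty groups A, since for A = ∅ the formula C_A φ holds vacuously and the axiom fails for false φ; all other S5 clauses of C_A, and (2) and (3), are stated for every A. *)

(* Defs.v *)
(* MathComp world. *)
From mathcomp Require Import all_boot.
From mathcomp Require Import boolp classical_sets.

Set Implicit Arguments.
Unset Strict Implicit.
Unset Printing Implicit Defensive.

Local Open Scope classical_set_scope.

(* The agents 1, ..., n are indexed by 'I_n; time is nat. *)
Definition node (n : nat) : Type := ('I_n * nat)%type.

Record global_state (n : nat) (Env : Type) (Loc : 'I_n -> Type) : Type :=
  GlobalState { env_state : Env; agent_state : forall i : 'I_n, Loc i }.

Definition run (n : nat) (Env : Type) (Loc : 'I_n -> Type) : Type :=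
  nat -> global_state Env Loc.

Definition system (n : nat) (Env : Type) (Loc : 'I_n -> Type) : Type :=
  set (run Env Loc).

(* Groups of nodes are arbitrary sets: possibly infinite, possibly empty. *)
Inductive formula (n : nat) (Event : Type) : Type :=
| Occurred of nat & Event
| And of formula n Event & formula n Event
| Not of formula n Event
| Know of node n & formula n Event
| Everyone of set (node n) & formula n Event
| Common of set (node n) & formula n Event.

Definition Or (n : nat) (Event : Type) (phi psi : formula n Event) :=
  Not (And (Not phi) (Not psi)).

Definition Imp (n : nat) (Event : Type) (phi psi : formula n Event) :=
  Or (Not phi) psi.

Section Semantics.
Variables (n : nat) (Env : Type) (Loc : 'I_n -> Type) (Event : Type).

(* [happens r s e]: event e takes place at time s in run r. The interpretation
   of events is arbitrary. *)
Variable happens : run Env Loc -> nat -> Event -> Prop.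

Implicit Types (R : system Env Loc) (r : run Env Loc) (P : set (run Env Loc)).

Definition occurred_by (t : nat) (e : Event) r : Prop :=
  exists2 s : nat, s <= t & happens r s e.

Definition knows R (a : node n) P r : Prop :=
  forall r', R r' ->
    agent_state (r a.2) a.1 = agent_state (r' a.2) a.1 -> P r'.

Definition everyone_knows R (A : set (node n)) P r : Prop :=
  forall a, A a -> knows R a P r.

(* E_A is iterated on truth sets, since the formulas (E_A)^k phi are not
   subformulas of C_A phi; [sat_Common] gives the clause on formulas. *)
Fixpoint sat R (phi : formula n Event) r : Prop :=
  match phi with
  | Occurred t e => occurred_by t e r
  | And phi1 phi2 => sat R phi1 r /\ sat R phi2 r
  | Not phi1 => ~ sat R phi1 r
  | Know a phi1 => knows R a (sat R phi1) r
  | Everyone A phi1 => everyone_knows R A (sat R phi1) r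
  | Common A phi1 =>
      forall k : nat, 1 <= k -> iter k (everyone_knows R A) (sat R phi1) r
  end.

Lemma sat_Everyone R A phi r :
  sat R (Everyone A phi) r <-> forall a, A a -> sat R (Know a phi) r.
Proof. by []. Qed.

Lemma sat_Common R A phi r :
  sat R (Common A phi) r <->
  forall k : nat, 1 <= k -> sat R (iter k (Everyone A) phi) r.
Proof.
have satE k : sat R (iter k (Everyone A) phi) =
    iter k (everyone_knows R A) (sat R phi) by elim: k => //= k ->.
by split=> h k /h; rewrite satE.
Qed.

Lemma sat_Imp R phi psi r :
  sat R (Imp phi psi) r <-> (sat R phi r -> sat R psi r).
Proof.
split=> [h hphi|h [hnn hpsi]]; last by apply: hnn => /h.
by apply: contrapT => hpsi; apply: h; split=> // hn; apply: hn.
Qed.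

Definition valid_in R (phi : formula n Event) : Prop :=
  forall r, R r -> sat R phi r.

Definition valid (phi : formula n Event) : Prop := forall R, valid_in R phi.

(* S5 without the axiom Box phi => phi. *)
Definition K45_modality (Box : formula n Event -> formula n Event) : Prop :=
  forall phi psi : formula n Event,
    [/\ valid (Imp (And (Box phi) (Box (Imp phi psi))) (Box psi)),
        valid (Imp (Box phi) (Box (Box phi))),
        valid (Imp (Not (Box phi)) (Box (Not (Box phi))))
      & valid phi -> valid (Box phi)].

Definition S5_modality (Box : formula n Event -> formula n Event) : Prop :=
  K45_modality Box /\
  forall phi : formula n Event, valid (Imp (Box phi) phi).

End Semantics.

(* Main.v *)
(* Every S5 clause for C_A other than reflexivity is an instance of the induction
   rule (3), applied to a formula that E_A preserves.  For negative
   introspection that formula is ~ C_A phi: indistinguishability at a node is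
   symmetric, so C_A phi at a run r' that some node of A cannot tell from r
   gives E_A C_A phi at r', and hence C_A phi at r. *)
Require Import Defs.
From mathcomp Require Import all_boot.
From mathcomp Require Import boolp classical_sets.
Local Open Scope classical_set_scope.

Section Knowledge.
Context {n : nat} {Env : Type} {Loc : 'I_n -> Type}.
Implicit Types (R : system Env Loc) (r : run Env Loc) (P Q : set (run Env Loc)).
Implicit Types (a : node n) (A : set (node n)).

Lemma knows_refl R a P r : R r -> knows R a P r -> P r.
Proof. by move=> Rr; apply. Qed.

(** Knowledge at a node depends on the run only through the local state there. Both introspection
    axioms of [Know] follow, negative introspection by reading the equality backwards. *)
Lemma knows_indist R a P r r' :
  agent_state (r a.2) a.1 = agent_state (r' a.2) a.1 ->
  knows R a P r -> knows R a P r'.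
Proof. by move=> rr' KP s Rs r's; apply: KP => //; rewrite rr'. Qed.

(** The clause of [sat] for [Common], on arbitrary sets of runs: results about it apply to formulas
    by conversion. *)
Definition commonly_known R A P r : Prop :=
  forall k : nat, 1 <= k -> iter k (everyone_knows R A) P r.

(** Peel off the outermost [everyone_knows]: level 1 leaves [P] at [r'], and level [k.+1] leaves
    level [k] there. *)
Lemma commonly_known_fixpoint R A P r : commonly_known R A P r ->
  everyone_knows R A (P `&` commonly_known R A P) r.
Proof.
move=> CP a Aa r' Rr' rr'; split; first exact: (CP 1 isT a Aa r' Rr' rr').
by move=> k _; exact: (CP k.+1 isT a Aa r' Rr' rr').
Qed.

Lemma commonly_known_ind R A P Q :
  (forall r, R r -> P r -> everyone_knows R A (P `&` Q) r) ->
  forall r, R r -> P r -> commonly_known R A Q r.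
Proof.
(* The run stays general because each level moves from [r] to [r']: [P] is carried along as the
   invariant, and [Q] is read off at the last level. *)
move=> PE r Rr Pr [//|k] _; elim: k r Rr Pr => [|k IHk] r Rr Pr a Aa r' Rr' rr'.
  by have [] := PE r Rr Pr a Aa r' Rr' rr'.
by apply: IHk => //; have [] := PE r Rr Pr a Aa r' Rr' rr'.
Qed.

Lemma commonly_known_refl R A P r :
  A !=set0 -> R r -> commonly_known R A P r -> P r.
Proof. by move=> [a Aa] Rr /(_ 1 isT a Aa); exact: knows_refl. Qed.

Lemma commonly_known_mp R A P Q r : R r ->
  commonly_known R A P r ->
  commonly_known R A [set s | P s -> Q s] r ->
  commonly_known R A Q r.
Proof.
move=> Rr CP CPQ.
(* The invariant is common knowledge of both premises; modus ponens is then applied at each run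
   reached. *)
apply: (@commonly_known_ind R A
  (commonly_known R A P `&` commonly_known R A [set s | P s -> Q s])) => //.
move=> s _ [/commonly_known_fixpoint EP /commonly_known_fixpoint EPQ].
move=> a Aa s' Rs' ss'.
have [Ps' CPs'] := EP a Aa s' Rs' ss'.
by have [PQs' CPQs'] := EPQ a Aa s' Rs' ss'; split; [split|exact: PQs'].
Qed.

Lemma commonly_known_trans R A P r : R r ->
  commonly_known R A P r -> commonly_known R A (commonly_known R A P) r.
Proof.
apply: commonly_known_ind => s _ /commonly_known_fixpoint EP a Aa s' Rs' ss'.
by have [_ CP] := EP a Aa s' Rs' ss'.
Qed.

Lemma commonly_known_eucl R A P r : R r ->
  ~ commonly_known R A P r ->
  commonly_known R A [set s | ~ commonly_known R A P s] r.
Proof.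
apply: (@commonly_known_ind R A [set s | ~ commonly_known R A P s]).
move=> s Rs nCP a Aa s' Rs' ss'; rewrite setIid => /commonly_known_fixpoint EP.
by apply: nCP; have [] := EP a Aa s Rs (esym ss').
Qed.

Lemma commonly_known_valid R A P r :
  (forall s, R s -> P s) -> R r -> commonly_known R A P r.
Proof.
move=> RP Rr; apply: (@commonly_known_ind R A setT) => // s _ _ a _ s' Rs' _.
by split=> //; exact: RP.
Qed.

(** An equality of truth sets, unlike the pointwise [sat_Imp], can be rewritten inside
    [commonly_known]. *)
Lemma sat_Imp_set {Event : Type} (happens : run Env Loc -> nat -> Event -> Prop)
    R (phi psi : formula n Event) :
  sat happens R (Imp phi psi) =
  [set r | sat happens R phi r -> sat happens R psi r].
Proof. by apply/funext => r; apply/propext; exact: sat_Imp. Qed.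

Lemma Know_K45 {Event : Type} (happens : run Env Loc -> nat -> Event -> Prop) a :
  K45_modality happens (@Know n Event a).
Proof.
move=> phi psi; split=> [R r Rr|R r Rr|R r Rr|vphi R r _ r' Rr' _].
- rewrite sat_Imp => -[Kphi Kimp] r' Rr' rr'.
  by have /sat_Imp := Kimp r' Rr' rr'; apply; exact: Kphi.
- by rewrite sat_Imp => Kphi r' _ rr'; exact: (knows_indist _ _ _ _ _ rr' Kphi).
- rewrite sat_Imp => nKphi r' _ rr' Kphi; apply: nKphi.
  exact: (knows_indist _ _ _ _ _ (esym rr') Kphi).
- exact: vphi.
Qed.

Lemma Common_K45 {Event : Type} (happens : run Env Loc -> nat -> Event -> Prop) A :
  K45_modality happens (@Common n Event A).
Proof.
move=> phi psi; split=> [R r Rr|R r Rr|R r Rr|vphi R r Rr].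
- rewrite sat_Imp => -[Cphi Cimp].
  apply: commonly_known_mp Rr Cphi _.
  by rewrite -sat_Imp_set.
- by rewrite sat_Imp; exact: commonly_known_trans.
- by rewrite sat_Imp; exact: commonly_known_eucl.
- by apply: commonly_known_valid => //; exact: vphi.
Qed.

End Knowledge.

(* For A = set0, C_A phi holds vacuously and C_A phi => phi is not valid, so
   this one S5 axiom of C_A is stated for nonempty A. *)
Theorem lemma2 (n : nat) (Env : Type) (Loc : 'I_n -> Type) (Event : Type)
    (happens : run Env Loc -> nat -> Event -> Prop)
    (i : 'I_n) (t : nat) (A : set (node n)) (phi psi : formula n Event) :
  (S5_modality happens (Know (i, t)) /\
   K45_modality happens (Common A) /\
   (A !=set0 -> S5_modality happens (Common A))) /\
  valid happens (Imp (Common A phi) (Everyone A (And phi (Common A phi)))) /\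
  (forall R : system Env Loc,
     valid_in happens R (Imp phi (Everyone A (And phi psi))) ->
     valid_in happens R (Imp phi (Common A psi))).
Proof.
split; [split; [|split]|split].
- split; first exact: Know_K45.
  by move=> chi R r Rr; rewrite sat_Imp; exact: knows_refl.
- exact: Common_K45.
- move=> A0; split; first exact: Common_K45.
  by move=> chi R r Rr; rewrite sat_Imp; exact: commonly_known_refl.
- by move=> R r _; rewrite sat_Imp; exact: commonly_known_fixpoint.
- move=> R vE r Rr; rewrite sat_Imp; apply: commonly_known_ind r Rr => s Rs.
  by move: (vE s Rs); rewrite sat_Imp.
Qed.
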